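(* Let $N\ge1$, let $a,b,\delta$ be constants, and let $\psi=\psi(n,m,l)$ be an $N$-component column vector function of $(n,m,l)\in\mathbb Z^3$ satisfying $$\overline\psi=\widetilde\psi+(\delta-a)\psi$$ together with its counterpart under the $n$-$m$-$l$ symmetry, $\overline\psi=\widehat\psi+(\delta-b)\psi$. Suppose there are $N$-component auxiliary vector functions $\sigma(n,m,l)$ and $\phi(n,m,l)$ and transform matrices $A_{[l]},A_{[n]},A_{[m]}$ such that $$\psi=A_{[l]}\,\sigma,\qquad \underline\sigma=-\widehat\sigma+(b+\delta)\sigma,$$ and $$\psi=A_{[n]}A_{[m]}\,\phi,\qquad \overline\phi(n,m,l)=-\phi(n-1,m,l)+(a+\delta)\phi(n,m,l),\qquad \overline\phi(n,m,l)=-\phi(n,m-1,l)+(b+\delta)\phi(n,m,l).$$ Then the Casoratians $$f=\det\big(\psi(n,m,l),\psi(n,m,l+1),\dots,\psi(n,m,l+N-1)\big),$$ $$\mathfrak g=\det\big(\psi(n,m,l-1),\psi(n,m,l+1),\psi(n,m,l+2),\dots,\psi(n,m,l+N-1)\big)$$ solve the bilinear system $$(b-\delta)\,\widehat{\widetilde{\overline f}}\,f+(a+\delta)\,\widehat{\widetilde f}\,\overline f-(a+b)\,\widetilde{\overline f}\,\widehat f=0,$$ $$(a-b)\,\widehat{\widetilde{\overline f}}\,f+(b+\delta)\,\widetilde{\overline f}\,\widehat f-(a+\delta)\,\widetilde f\,\widehat{\overline f}=0,$$ $$-\widetilde{\overline f}\,\widehat f+(\delta-a)\,\widetilde{\overline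 f}\,\widehat{\mathfrak g}+\widetilde f\,\widehat{\overline f}+(b-\delta)\,\widehat{\overline f}\,\widetilde{\mathfrak g}+(a-b)\,\overline f\,\widehat{\widetilde{\mathfrak g}}=0,$$ $$(a-b)\,\widehat{\widetilde{\overline f}}\,\mathfrak g+(a+b)\,\widetilde{\overline f}\,\widehat{\mathfrak g}-(a+b)\,\widehat{\overline f}\,\widetilde{\mathfrak g}+(b-a)\,\overline f\,\widehat{\widetilde{\mathfrak g}}=0$$ at every $(n,m,l)$.
   Context: All functions are complex valued on the lattice $(n,m,l)\in\mathbb Z^3$; $a,b,\delta$ are complex constants associated with the directions $n,m,l$ respectively. Shift notation: for $u=u(n,m,l)$, $\widetilde u=u(n+1,m,l)$, $\widehat u=u(n,m+1,l)$, $\overline u=u(n,m,l+1)$, $\underline u=u(n,m,l-1)$; combined accents denote combined shifts, e.g. $\widehat{\widetilde{\overline f}}=f(n+1,m+1,l+1)$. The ''$n$-$m$-$l$ symmetric property'' means that the shift relation for $\psi$ is required to hold under permutation of the pairs $(n,a),(m,b),(l,\delta)$. A transform matrix $A_{[\mu]}$ ($\mu\in\{n,m,l\}$) is an invertible $N\times N$ matrix depending only on $\mu$ (and not on the other two lattice variables) such that $A_{[\mu]}A_{[\mu+1]}^{-1}$ is independent of $\mu$. For $N=1$, $\mathfrak g=\psi(n,m,l-1)$. (This system is a bilinear form of the lattice equation Q1: $p(u-\widehat u)(\widetilde u-\widehat{\widetilde u})-q(u-\widetilde u)(\widehat u-\widehat{\widetilde u})+\delta^2pq(p-q)=0$.)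 *)

(* Defs.v *)
From mathcomp Require Import all_boot all_order all_algebra.
From mathcomp Require Import reals complex.

Set Implicit Arguments.
Unset Strict Implicit.
Unset Printing Implicit Defensive.

Import Order.TTheory GRing.Theory Num.Theory.
Local Open Scope ring_scope.

(* Functions of (n, m, l) in Z^3; the arguments come in this order. *)
Definition lattice (T : Type) : Type := int -> int -> int -> T.

(* Shifts; these are the accents tilde, hat, overline and underline. *)
Definition tld (T : Type) (u : lattice T) : lattice T :=
  fun n m l => u (n + 1) m l.
Definition hat (T : Type) (u : lattice T) : lattice T :=
  fun n m l => u n (m + 1) l.
Definition bar (T : Type) (u : lattice T) : lattice T :=
  fun n m l => u n m (l + 1).
Definition under (T : Type) (u : lattice T) : lattice T :=
  fun n m l => u n m (l - 1).

Definition transform_matrix (K : fieldType) (N : nat) (A : int -> 'M[K]_N)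
  : Prop :=
  (forall mu, A mu \in unitmx) /\
  (forall mu nu, A mu *m invmx (A (mu + 1)) = A nu *m invmx (A (nu + 1))).

(* det (psi(n, m, l + s 0), ..., psi(n, m, l + s (N - 1))), by columns. *)
Definition casoratian (K : fieldType) (N : nat) (s : nat -> int)
    (psi : lattice 'cV[K]_N) : lattice K :=
  fun n m l => \det (\matrix_(i < N, j < N) psi n m (l + s j) i 0).

Definition cas_f (K : fieldType) (N : nat) (psi : lattice 'cV[K]_N)
  : lattice K := casoratian (fun j => j%:Z) psi.

(* l-shifts -1, 1, 2, ..., N - 1; just -1 for N = 1. *)
Definition cas_g (K : fieldType) (N : nat) (psi : lattice 'cV[K]_N)
  : lattice K := casoratian (fun j => if j == 0%N then -1 else j%:Z) psi.

(* Main.v *)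
(* Let E be the shift in l. Then tilde, hat and bar act on psi as E - s with
   s = delta - a, delta - b and 0. The Casoratian of (E - s) psi is that of psi
   bordered by the row (1, s, s^2, ...); iterating, one borders by divided
   differences of such rows, and f itself (in a larger determinant) by the last
   unit row, g by the unit row in position 1. Two identities result, valid for an
   arbitrary sequence: they are Pluecker relations among 2 x 2, respectively
   3 x 3, determinants of linear forms in the bordering rows (seqdet_hirota and
   seqdet_gap_identity).

   The auxiliary functions say that E - (delta + a) maps psi(n + 1) to D psi(n)
   with D invertible, that E - (delta + b) does so from m + 1 to m, and
   E - 2 delta from l + 1 to l - 1. So -a, -b and -delta act as further
   parameters that undo the shifts up to a constant. The first two equations are
   the Hirota identity with parameters (b, delta, -a) at n + 1 and (a, b, -delta)
   at l + 1. The third is the gap identity for (a, b). The fourth is the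
   difference of the gap identities for (-a, b) at n + 1 and (-b, a) at m + 1. *)

Require Import Defs.
From mathcomp Require Import all_boot all_order all_algebra.
From mathcomp Require Import reals complex.
From mathcomp Require Import ring.
From Stdlib Require Import Classical FunctionalExtensionality.

Import Order.TTheory GRing.Theory Num.Theory.
Local Open Scope ring_scope.

(** * Determinants of sequences under twisting and bordering *)

Section SequenceDeterminants.

Variable K : fieldType.
Implicit Types (r : nat -> K) (s t a b c : K).

Definition seqdet {m} (x : 'I_m -> nat -> K) : K :=
  \det (\matrix_(i < m, j < m) x i j).

Definition seqdet_gap {m} (x : 'I_m -> nat -> K) : K :=
  \det (\matrix_(i < m, j < m) x i (bump 1 j)).

Definition twist s {m} (x : 'I_m -> nat -> K) : 'I_m -> nat -> K :=
  fun i j => x i j.+1 - s * x i j.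

Definition border r {m} (x : 'I_m -> nat -> K) : 'I_m.+1 -> nat -> K :=
  fun i => oapp x r (unlift ord0 i).

Definition geom s : nat -> K := fun j => s ^+ j.

Definition unit_seq (k : nat) : nat -> K := fun j => (j == k)%:R.

(** The solution y of (E - s) y = r with y 0 = 0. On [geom t] it is the divided difference (s^j -
    t^j) / (s - t); the recursion avoids the division, so s = t is allowed. *)
Fixpoint divdiff s r (j : nat) : K :=
  if j is k.+1 then r k + s * divdiff s r k else 0.

Lemma border0 r m (x : 'I_m -> nat -> K) : border r x ord0 = r.
Proof. by rewrite /border unlift_none. Qed.

Lemma borderS r m (x : 'I_m -> nat -> K) i : border r x (lift ord0 i) = x i.
Proof. by rewrite /border liftK. Qed.

Lemma twistC s t m (x : 'I_m -> nat -> K) :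
  twist s (twist t x) = twist t (twist s x).
Proof.
apply: functional_extensionality => i; apply: functional_extensionality => j.
by rewrite /twist /=; ring.
Qed.

(** [divdiff s] is a right inverse of E - s, so a border row can be moved inside a twist. Iterated
    twists thus become iterated borders of one fixed family. *)
Lemma twist_border s r m (x : 'I_m -> nat -> K) :
  twist s (border (divdiff s r) x) = border r (twist s x).
Proof.
apply: functional_extensionality => i; apply: functional_extensionality => j.
case: (unliftP ord0 i) => [i' ->|->]; rewrite /twist ?borderS ?border0 //=.
by rewrite addrK.
Qed.

Lemma seqdet_border m r (x : 'I_m -> nat -> K) (k : 'I_m.+1) :
  (forall j : 'I_m.+1, j != k -> r j = 0) ->
  seqdet (border r x) =
  r k * ((-1) ^+ k * \det (\matrix_(i < m, j < m) x i (bump k j))).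
Proof.
move=> r0; rewrite /seqdet (expand_det_row _ ord0) (bigD1 k) //= big1 ?addr0.
  rewrite mxE border0 /cofactor add0n; congr (_ * (_ * \det _)).
  by apply/matrixP=> i j; rewrite !mxE borderS.
by move=> j jk; rewrite mxE border0 r0 ?mul0r.
Qed.

(** Subtracting s times each column from the next one is multiplication by the unitriangular matrix
    [S]. It turns the border row [geom s] into (1, 0, ..., 0) and the remaining rows, past column 0,
    into their twists. *)
Lemma seqdet_twist s m (x : 'I_m -> nat -> K) :
  seqdet (twist s x) = seqdet (border (geom s) x).
Proof.
pose y := border (geom s) x.
pose y' (i : 'I_m.+1) j := if j is k.+1 then twist s y i k else y i 0%N.
pose S := \matrix_(k < m.+1, j < m.+1)
  ((k == j)%:R - s * ((k.+1 == j :> nat)%:R : K)).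
have detS : \det S = 1.
  rewrite -det_tr det_trig; last first.
    apply/is_trig_mxP => i j ij; rewrite !mxE -val_eqE /=.
    by rewrite (gtn_eqF ij) (gtn_eqF (ltnW _)) ?mulr0 ?subr0 // ltnS ltnW.
  apply: big1 => i _; rewrite !mxE eqxx (gtn_eqF (ltnSn _)).
  by rewrite mulr0 subr0.
have yS : (\matrix_(i < m.+1, j < m.+1) y i j) *m S =
          \matrix_(i < m.+1, j < m.+1) y' i j.
  apply/matrixP=> i j; rewrite !mxE.
  rewrite (bigD1 j) //= !mxE eqxx (gtn_eqF (ltnSn _)) mulr0 subr0 mulr1.
  case: (unliftP ord0 j) => [j'|] ->.
    have jj' : widen_ord (leqnSn m) j' != lift ord0 j'.
      by rewrite -val_eqE /= /bump /= add1n ltn_eqF.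
    rewrite (bigD1 (widen_ord (leqnSn m) j')) //= !mxE (negPf jj') /=.
    rewrite /bump /= !add1n eqxx big1 => [|k /andP[kj kj']].
      by rewrite /twist /= !add0n; ring.
    rewrite !mxE (negPf kj) /= /bump /= add1n eqSS.
    by rewrite -val_eqE /= in kj'; rewrite (negPf kj') mulr0 subr0 mulr0.
  rewrite big1 ?addr0 //= => k kj.
  by rewrite !mxE (negPf kj) mulr0 subr0 mulr0.
have -> : seqdet y = seqdet y' by rewrite /seqdet -yS det_mulmx detS mulr1.
have -> : y' = border (unit_seq 0)
                 (fun i j => if j is k.+1 then twist s x i k else x i 0%N).
  apply: functional_extensionality => i; apply: functional_extensionality.
  rewrite /y' /y => -[|k]; case: (unliftP ord0 i) => [i' ->|->].
  - by rewrite !borderS.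
  - by rewrite !border0.
  - by rewrite /twist !borderS.
  - by rewrite /twist !border0 /geom /unit_seq exprS subrr.
rewrite (seqdet_border _ _ _ (ord0)); last first.
  by move=> j j0; rewrite /unit_seq -[0%N]/(nat_of_ord (@ord0 m)) val_eqE (negPf j0).
by rewrite /unit_seq eqxx expr0 !mul1r.
Qed.

(** Raises the size of a determinant by one, so that the two factors of every product below can be
    given the same number of border rows. *)
Lemma seqdet_border_last m (x : 'I_m -> nat -> K) :
  seqdet (border (unit_seq m) x) = (-1) ^+ m * seqdet x.
Proof.
rewrite (seqdet_border _ _ _ (ord_max)); last first.
  by move=> j jm; rewrite /unit_seq -[X in _ == X]/(nat_of_ord (@ord_max m)) val_eqE
    (negPf jm).
rewrite /unit_seq eqxx mul1r; congr (_ * \det _); apply/matrixP=> i j.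
by rewrite !mxE /bump leqNgt ltn_ord.
Qed.

Lemma seqdet_border_gap m (x : 'I_m.+1 -> nat -> K) :
  seqdet (border (unit_seq 1) x) = - seqdet_gap x.
Proof.
rewrite (seqdet_border _ _ _ (lift ord0 ord0)); last first.
  by move=> j j1; rewrite /unit_seq -[X in _ == X]/(nat_of_ord (lift (@ord0 m.+1) ord0))
    val_eqE (negPf j1).
by rewrite /unit_seq /= mul1r expr1 mulN1r.
Qed.

(** * Determinants with fixed last rows as small determinants of linear forms *)

Definition linear_form (p : (nat -> K) -> K) : Prop :=
  forall r x y c, (forall j, r j = x j + c * y j) -> p r = p x + c * p y.

(* If some choice P of the first k rows gives an invertible matrix, multiplying
   by its inverse reduces the other rows to (0 | 1). *)
Lemma seqdet_quotient k m (u : 'I_m -> nat -> K) :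
  exists (d : K) (p : 'I_k -> (nat -> K) -> K), (forall i, linear_form (p i)) /\
  forall x : 'I_(k + m) -> nat -> K, (forall i, x (rshift k i) = u i) ->
  seqdet x = d * \det (\matrix_(i, j) p j (x (lshift m i))).
Proof.
pose U : 'M[K]_(m, k + m) := \matrix_(i, j) u i j.
have xU (x : 'I_(k + m) -> nat -> K) : (forall i, x (rshift k i) = u i) ->
    \matrix_(i < k + m, j < k + m) x i j =
    col_mx (\matrix_(i < k, j < k + m) x (lshift m i) j) U.
  move=> xu; apply/matrixP=> i j; rewrite mxE.
  by case: (split_ordP i) => i' ->; rewrite ?col_mxEu ?col_mxEd !mxE ?xu.
have [[P P_neq0]|P_eq0] := classic (exists P, \det (col_mx P U) != 0); last first.
  (* Here every determinant with last rows [u] vanishes, so d = 0 works. *)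
  exists 0, (fun _ _ => 0); split=> [_ r x y c _|x /xU].
    by rewrite mulr0 addr0.
  rewrite mul0r /seqdet => ->.
  by apply/eqP/negPn/negP => x_neq0; apply: P_eq0; eexists; exact: x_neq0.
set B := col_mx P U in P_neq0.
have Bu : B \in unitmx by rewrite unitmxE unitfE.
pose L := lsubmx (invmx B).
(* The forms are the coordinates of a row along the rows of [P], in the basis given by the rows of
   [B]. *)
exists (\det B), (fun i r => \sum_h r (nat_of_ord h) * L h i); split.
  move=> i r x y c rxy; rewrite mulr_sumr -big_split /=.
  by apply: eq_bigr => j _; rewrite rxy mulrDl mulrA.
move=> x xu.
rewrite /seqdet (xU _ xu); set X := \matrix_(i < k, j < k + m) x _ _.
rewrite [X in _ = _ * \det X](_ : _ = X *m L); last first.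
  by apply/matrixP=> i j; rewrite !mxE; apply: eq_bigr => h _; rewrite !mxE.
rewrite -[X in \det X = _](mulmxKV Bu) det_mulmx mulrC; congr (_ * _).
have UB : U *m invmx B = row_mx 0 1%:M.
  have /(congr1 dsubmx) := mulmxV Bu.
  by rewrite mul_col_mx col_mxKd scalar_mx_block col_mxKd.
rewrite mul_col_mx UB -[X *m invmx B]hsubmxK -/(block_mx _ _ _ _) det_ublock.
by rewrite det1 mulr1 mulmx_lsub.
Qed.


(** * Calculus of divided differences *)

Lemma divdiff_lin s r x y c :
  (forall j, r j = x j + c * y j) ->
  forall j, divdiff s r j = divdiff s x j + c * divdiff s y j.
Proof.
move=> rxy; elim=> [|j IH] /=; first by rewrite mulr0 addr0.
by rewrite rxy IH; ring.
Qed.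

(** The resolvent identity for the inverses of E - s and E - t. *)
Lemma divdiff_resolvent s t r j :
  divdiff s r j = divdiff t r j + (s - t) * divdiff s (divdiff t r) j.
Proof.
elim: j => [|j IH] /=; first by rewrite mulr0 addr0.
by rewrite {1}IH; ring.
Qed.

Lemma divdiffC s t r : divdiff s (divdiff t r) = divdiff t (divdiff s r).
Proof.
apply: functional_extensionality; elim=> //= j IH.
by rewrite -IH (divdiff_resolvent s t r j); ring.
Qed.

(** Both sides agree at j = 0, and E - t sends both to (s - t) [geom s]. *)
Lemma geom_divdiff s t j : geom s j = geom t j + (s - t) * divdiff t (geom s) j.
Proof.
elim: j => [|j IH] /=; first by rewrite /geom !expr0 mulr0 addr0.
by rewrite {1 2}/geom !exprS -[s ^+ j]/(geom s j) -[t ^+ j]/(geom t j) IH; ring.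
Qed.

Lemma divdiff_geomC s t : divdiff s (geom t) = divdiff t (geom s).
Proof.
apply: functional_extensionality; elim=> //= j IH.
by rewrite -IH (geom_divdiff t s j); ring.
Qed.

(** The derivative of s^j at s = 0 is a divided difference with both nodes at 0; this brings the gap
    determinants into the same calculus. *)
Lemma unit_seq1 : unit_seq 1 = divdiff 0 (geom 0).
Proof.
apply: functional_extensionality => -[|[|j]] //=.
  by rewrite /geom expr0 mul0r addr0.
by rewrite /geom expr0n mul0r addr0.
Qed.


(** * Pluecker identities among determinants with two or three border rows *)

Lemma det_mx22 (A : 'M[K]_2) (i0 := ord0) (i1 := lift ord0 ord0) :
  \det A = A i0 i0 * A i1 i1 - A i0 i1 * A i1 i0.
Proof.
rewrite (expand_det_row _ i0) !big_ord_recl big_ord0 /cofactor !det_mx11 !mxE /=.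
rewrite (_ : lift (lift _ _) _ = i0); last exact: val_inj.
rewrite (_ : lift i0 ord0 = i1) // /bump /= !add0n addn0 expr0 expr1.
by rewrite mul1r mulN1r mulrN addr0.
Qed.
Lemma det_mx33 (A : 'M[K]_3) (i0 := ord0) (i1 := lift ord0 ord0)
    (i2 := lift ord0 (lift ord0 ord0)) :
  \det A = A i0 i0 * (A i1 i1 * A i2 i2 - A i1 i2 * A i2 i1)
          - A i0 i1 * (A i1 i0 * A i2 i2 - A i1 i2 * A i2 i0)
          + A i0 i2 * (A i1 i0 * A i2 i1 - A i1 i1 * A i2 i0).
Proof.
rewrite (expand_det_row _ i0) !big_ord_recl big_ord0 /cofactor !det_mx22 !mxE /=.
have l10 : lift (lift ord0 ord0) ord0 = i0 by exact: val_inj.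
have l11 : lift (lift ord0 ord0) (lift ord0 ord0) = i2 by exact: val_inj.
have l20 : lift (lift ord0 (lift ord0 ord0)) ord0 = i0 by exact: val_inj.
have l21 : lift (lift ord0 (lift ord0 ord0)) (lift ord0 ord0) = i1.
  by exact: val_inj.
rewrite l10 l11 l20 l21 /bump /= !add0n !addn0 expr0 expr1 sqrrN expr1n.
by rewrite !mul1r mulN1r mulrN addr0 addrA.
Qed.

Lemma linear_formZ d p : linear_form p -> linear_form (fun r => d * p r).
Proof. by move=> lin_p r x y c /lin_p->; ring. Qed.

Lemma seqdet_border2 m (u : 'I_m -> nat -> K) :
  exists p1 p2, [/\ linear_form p1, linear_form p2 & forall r1 r2,
  seqdet (border r1 (border r2 u)) = p1 r1 * p2 r2 - p2 r1 * p1 r2].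
Proof.
have [d [p [lin_p det_p]]] := seqdet_quotient 2 m u.
(* The scalar d is absorbed into one column of the small determinant. *)
exists (fun r => d * p ord0 r), (p (lift ord0 ord0)).
split=> // [|r1 r2]; first exact: linear_formZ.
rewrite (det_p (border r1 (border r2 u))); last first.
  move=> i; rewrite (_ : rshift 2 i = lift ord0 (lift ord0 i)) ?borderS //.
  exact: val_inj.
have i0 : lshift m (@ord0 1) = ord0 by exact: val_inj.
have i1 : lshift m (lift (@ord0 1) ord0) = lift ord0 ord0 by exact: val_inj.
rewrite det_mx22 !mxE i0 i1 !(borderS, border0) /=.
by move: (p _) (p _) => p1 p2; ring.
Qed.

Lemma seqdet_border3 m (u : 'I_m -> nat -> K) :
  exists p1 p2 p3, [/\ linear_form p1, linear_form p2, linear_form p3 &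
  forall r1 r2 r3, seqdet (border r1 (border r2 (border r3 u))) =
    p1 r1 * (p2 r2 * p3 r3 - p3 r2 * p2 r3)
    - p2 r1 * (p1 r2 * p3 r3 - p3 r2 * p1 r3)
    + p3 r1 * (p1 r2 * p2 r3 - p2 r2 * p1 r3)].
Proof.
have [d [p [lin_p det_p]]] := seqdet_quotient 3 m u.
exists (fun r => d * p ord0 r), (p (lift ord0 ord0)),
  (p (lift ord0 (lift ord0 ord0))).
split=> // [|r1 r2 r3]; first exact: linear_formZ.
rewrite (det_p (border r1 (border r2 (border r3 u)))); last first.
  move=> i; rewrite (_ : rshift 3 i = lift ord0 (lift ord0 (lift ord0 i))).
    by rewrite !borderS.
  exact: val_inj.
have i0 : lshift m (@ord0 2) = ord0 by exact: val_inj.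
have i1 : lshift m (lift (@ord0 2) ord0) = lift ord0 ord0 by exact: val_inj.
have i2 : lshift m (lift (@ord0 2) (lift ord0 ord0)) =
    lift ord0 (lift ord0 ord0) by exact: val_inj.
rewrite det_mx33 !mxE i0 i1 i2 !(borderS, border0) /=.
by move: (p ord0) (p (lift ord0 ord0)) (p _) => p1 p2 p3; ring.
Qed.

(** Times b - a, the border rows [geom a], [divdiff a (geom b)] of the double twist amount to
    [geom a], [geom b]. The claim is then the three-term Pluecker relation for the rows of a, b, c
    and the last unit row. *)
Lemma seqdet_hirota a b c m (u : 'I_m -> nat -> K) :
  (a - b) * seqdet (twist b (twist a u)) * seqdet (twist c u)
  + (b - c) * seqdet (twist c (twist b u)) * seqdet (twist a u)
  + (c - a) * seqdet (twist c (twist a u)) * seqdet (twist b u) = 0.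
Proof.
have one s : seqdet (twist s u) =
    (-1) ^+ m.+1 * seqdet (border (unit_seq m.+1) (border (geom s) u)).
  by rewrite seqdet_border_last mulrA -exprMn mulrNN mulr1 expr1n mul1r seqdet_twist.
have two s t : seqdet (twist t (twist s u)) =
    seqdet (border (geom s) (border (divdiff s (geom t)) u)).
  by rewrite seqdet_twist -(twist_border s) seqdet_twist.
rewrite !two !one.
have [p1 [p2 [lin_p1 lin_p2 det_p]]] := seqdet_border2 m u.
rewrite !{}det_p.
(* Newton interpolation: besides the unit row, every border row is a combination of [geom a],
   [divdiff a (geom b)] and [x]. No division occurs, so coinciding parameters need no separate
   case. *)
pose x := divdiff b (divdiff a (geom c)).
have geom_b p : linear_form p ->
    p (geom b) = p (geom a) + (b - a) * p (divdiff a (geom b)).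
  by apply=> j; exact: geom_divdiff.
have geom_c p : linear_form p ->
    p (geom c) = p (geom a) + (c - a) * p (divdiff a (geom c)).
  by apply=> j; exact: geom_divdiff.
have divdiff_ac p : linear_form p ->
    p (divdiff a (geom c)) = p (divdiff a (geom b)) + (c - b) * p x.
  apply; rewrite /x (divdiffC b); apply: divdiff_lin => j; exact: geom_divdiff.
have divdiff_bc p : linear_form p ->
    p (divdiff b (geom c)) = p (divdiff a (geom b)) + (c - a) * p x.
  by apply; rewrite (divdiff_geomC a); apply: divdiff_lin => j; exact: geom_divdiff.
rewrite !(geom_b, geom_c, divdiff_bc) // !divdiff_ac //.
move: (_ ^+ _) (p1 _) (p1 (geom a)) (p1 (divdiff a _)) (p1 x) => e i1 z1 y1 x1.
move: (p2 _) (p2 (geom a)) (p2 (divdiff a _)) (p2 x) => i2 z2 y2 x2.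
ring.
Qed.

(** Triple twists and doubly twisted gaps border [u] by three rows; double twists and singly twisted
    gaps border it by two, and [addinf] adds the last unit row as the third. *)
Lemma seqdet_gap_identity a b m (u : 'I_m.+1 -> nat -> K) :
  - seqdet (twist a (twist 0 (twist 0 u))) * seqdet (twist b (twist 0 u))
  + a * seqdet (twist a (twist 0 (twist 0 u))) * seqdet_gap (twist b u)
  + seqdet (twist a (twist 0 u)) * seqdet (twist b (twist 0 (twist 0 u)))
  - b * seqdet (twist b (twist 0 (twist 0 u))) * seqdet_gap (twist a u)
  + (b - a) * seqdet (twist 0 (twist 0 u)) * seqdet_gap (twist a (twist b u)) = 0.
Proof.
pose y := divdiff 0 (geom 0); have unit_y : unit_seq 1 = y := unit_seq1.
have addinf r1 r2 : seqdet (border r1 (border r2 u)) =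
    (-1) ^+ m.+3 * seqdet (border (unit_seq m.+3) (border r1 (border r2 u))).
  by rewrite seqdet_border_last mulrA -exprMn mulrNN mulr1 expr1n mul1r.
have det2 s t : seqdet (twist t (twist s u)) =
    seqdet (border (geom s) (border (divdiff s (geom t)) u)).
  by rewrite seqdet_twist -(twist_border s) seqdet_twist.
have det3 s : seqdet (twist s (twist 0 (twist 0 u))) =
    seqdet (border (geom 0) (border y (border (divdiff 0 (divdiff 0 (geom s))) u))).
  by rewrite seqdet_twist -!(twist_border 0) seqdet_twist -(twist_border 0) seqdet_twist.
have gap1 s : seqdet_gap (twist s u) =
    - seqdet (border (geom s) (border (divdiff s y) u)).
  by rewrite -seqdet_twist twist_border -unit_y seqdet_border_gap opprK.
have gap2 s t : seqdet_gap (twist s (twist t u)) = - seqdet (border (geom t)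
    (border (divdiff t (geom s)) (border (divdiff t (divdiff s y)) u))).
  rewrite -seqdet_twist !twist_border -seqdet_twist twist_border -unit_y.
  by rewrite seqdet_border_gap opprK.
(* Both are the divided difference of t^j at the nodes 0, 0, s, which is symmetric in its nodes. *)
have divdiff_y s : divdiff 0 (divdiff 0 (geom s)) = divdiff s y.
  by rewrite /y (divdiffC s) (divdiff_geomC s).
rewrite !det3 !det2 !gap2 !gap1 !divdiff_y !addinf.
have [p1 [p2 [p3 [lin_p1 lin_p2 lin_p3 det_p]]]] := seqdet_border3 m.+1 u.
rewrite !{}det_p.
(* All border rows are now expanded in five: the unit row, [geom 0], [y], [divdiff a y] and
   [divdiff b (divdiff a y)]. *)
have geom0 s p : linear_form p ->
    p (geom s) = p (geom 0) + s * p (divdiff 0 (geom s)).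
  by apply=> j; rewrite {1}(geom_divdiff s 0) subr0.
have divdiff_geom s j : divdiff 0 (geom s) j = y j + s * divdiff s y j.
  rewrite -divdiff_y; apply: divdiff_lin => k.
  by rewrite {1}(geom_divdiff s 0) subr0.
have divdiff0 s p : linear_form p ->
    p (divdiff 0 (geom s)) = p y + s * p (divdiff s y).
  by apply=> j; exact: divdiff_geom.
have divdiff_ba p : linear_form p -> p (divdiff b (geom a)) =
    p (divdiff 0 (geom b)) + a * (p (divdiff b y) + a * p (divdiff b (divdiff a y))).
  move=> lin_p; rewrite (divdiff_geomC 0) -(lin_p (divdiff b (divdiff 0 (geom a)))).
    apply: lin_p; apply: divdiff_lin => j.
    by rewrite {1}(geom_divdiff a 0) subr0.
  by apply: divdiff_lin; exact: divdiff_geom.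
have divdiff_b p : linear_form p -> p (divdiff b y) =
    p (divdiff a y) + (b - a) * p (divdiff b (divdiff a y)).
  by apply=> j; exact: divdiff_resolvent.
clearbody y.
rewrite !(divdiff_ba _ lin_p1, divdiff_ba _ lin_p2, divdiff_ba _ lin_p3).
rewrite !(geom0 a _ lin_p1, geom0 a _ lin_p2, geom0 a _ lin_p3, geom0 b _ lin_p1, geom0 b _ lin_p2, geom0 b _ lin_p3).
rewrite !(divdiff0 _ _ lin_p1, divdiff0 _ _ lin_p2, divdiff0 _ _ lin_p3).
rewrite !(divdiff_b _ lin_p1, divdiff_b _ lin_p2, divdiff_b _ lin_p3).
move: (_ ^+ _) => e.
move: (p1 (unit_seq _)) (p1 (geom 0)) (p1 y) (p1 (divdiff a y)) (p1 (divdiff b _)).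
move: (p2 (unit_seq _)) (p2 (geom 0)) (p2 y) (p2 (divdiff a y)) (p2 (divdiff b _)).
move: (p3 (unit_seq _)) (p3 (geom 0)) (p3 y) (p3 (divdiff a y)) (p3 (divdiff b _)).
move=> i3 z3 y3 a3 b3 i2 z2 y2 a2 b2 i1 z1 y1 a1 b1. ring.
Qed.

(** * Casoratians as determinants of orbits in l *)

Lemma seqdet_mulmx m (D : 'M[K]_m) (x y : 'I_m -> nat -> K) :
  (forall i j, y i j = \sum_k D i k * x k j) ->
  seqdet y = \det D * seqdet x /\ seqdet_gap y = \det D * seqdet_gap x.
Proof.
move=> yDx; rewrite /seqdet /seqdet_gap -!det_mulmx.
by split; congr (\det _); apply/matrixP=> i j; rewrite !mxE yDx;
  apply: eq_bigr => k _; rewrite !mxE.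
Qed.

Definition orbit_rows {N} (v : int -> 'cV[K]_N) (l : int) : 'I_N -> nat -> K :=
  fun i j => v (l + j%:Z) i 0.

Lemma twist_orbit_rows N (v w : int -> 'cV[K]_N) s l :
  (forall k, v (k + 1) = w k + s *: v k) ->
  twist s (orbit_rows v l) = orbit_rows w l.
Proof.
move=> vw; apply: functional_extensionality => i.
apply: functional_extensionality => j; rewrite /twist /orbit_rows.
by rewrite -(addn1 j) PoszD addrA vw !mxE addrK.
Qed.

Lemma twist0_orbit_rows N (v : int -> 'cV[K]_N) l :
  twist 0 (orbit_rows v l) = orbit_rows v (l + 1).
Proof.
rewrite (twist_orbit_rows _ _ (fun k => v (k + 1))) => [|k]; last first.
  by rewrite scale0r addr0.
apply: functional_extensionality => i; apply: functional_extensionality => j.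
by rewrite /orbit_rows addrAC.
Qed.

Lemma seqdet_orbit_mulmx N (D : 'M[K]_N) (v : int -> 'cV[K]_N) l :
  let Dv k := D *m v k in
  seqdet (orbit_rows Dv l) = \det D * seqdet (orbit_rows v l) /\
  seqdet_gap (orbit_rows Dv l) = \det D * seqdet_gap (orbit_rows v l).
Proof. by apply: seqdet_mulmx => i j; rewrite /orbit_rows mxE. Qed.

(** The orbit starts at l, which is shift -1 seen from l + 1, so the skipped column 1 is exactly
    shift 0. *)
Lemma cas_g_orbit N (psi : lattice 'cV[K]_N) n m l :
  cas_g psi n m (l + 1) = seqdet_gap (orbit_rows (psi n m) l).
Proof.
rewrite /cas_g /casoratian; congr (\det _); apply/matrixP=> i j.
rewrite !mxE /orbit_rows; congr (psi n m _ i 0); rewrite -addrA; congr (_ + _).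
by case: (nat_of_ord j) => [|k].
Qed.

Lemma seqdet_reduction N (D : 'M[K]_N) (v w : int -> 'cV[K]_N) s :
  (forall k, v (k + 1) = D *m w k + s *: v k) -> forall l,
  seqdet (twist s (orbit_rows v l)) = \det D * seqdet (orbit_rows w l) /\
  seqdet_gap (twist s (orbit_rows v l)) = \det D * seqdet_gap (orbit_rows w l).
Proof. by move=> /twist_orbit_rows vw l; rewrite vw; exact: seqdet_orbit_mulmx. Qed.

(** Isolates what the auxiliary functions contribute: twists that undo a shift up to a nonzero
    factor. For the n-reduction the factor is the same at all m and l, so it is common to all terms
    of one identity and cancels; likewise for the other two. *)
Lemma bilinear_of_reductions N a b delta (psi : lattice 'cV[K]_N.+1)
    (rows := fun n m l => orbit_rows (psi n m) l) (f := cas_f psi) (g := cas_g psi) :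
  (forall n m l, bar psi n m l = tld psi n m l + (delta - a) *: psi n m l) ->
  (forall n m l, bar psi n m l = hat psi n m l + (delta - b) *: psi n m l) ->
  (forall n, exists2 d, d != 0 & forall m l,
    seqdet (twist (a + delta) (rows (n + 1) m l)) = d * seqdet (rows n m l) /\
    seqdet_gap (twist (a + delta) (rows (n + 1) m l)) =
      d * seqdet_gap (rows n m l)) ->
  (forall m, exists2 d, d != 0 & forall n l,
    seqdet (twist (b + delta) (rows n (m + 1) l)) = d * seqdet (rows n m l) /\
    seqdet_gap (twist (b + delta) (rows n (m + 1) l)) =
      d * seqdet_gap (rows n m l)) ->
  (exists2 d, d != 0 & forall n m l,
    seqdet (twist (delta + delta) (rows n m (l + 1))) = d * seqdet (rows n m l)) ->
  forall n m l : int,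
  [/\ (b - delta) * hat (tld (bar f)) n m l * f n m l
      + (a + delta) * hat (tld f) n m l * bar f n m l
      - (a + b) * tld (bar f) n m l * hat f n m l = 0,
      (a - b) * hat (tld (bar f)) n m l * f n m l
      + (b + delta) * tld (bar f) n m l * hat f n m l
      - (a + delta) * tld f n m l * hat (bar f) n m l = 0,
      - tld (bar f) n m l * hat f n m l
      + (delta - a) * tld (bar f) n m l * hat g n m l
      + tld f n m l * hat (bar f) n m l
      + (b - delta) * hat (bar f) n m l * tld g n m l
      + (a - b) * bar f n m l * hat (tld g) n m l = 0
    & (a - b) * hat (tld (bar f)) n m l * g n m l
      + (a + b) * tld (bar f) n m l * hat g n m l
      - (a + b) * hat (bar f) n m l * tld g n m l
      + (b - a) * bar f n m l * hat (tld g) n m l = 0].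
Proof.
move=> psi_n psi_m red_n red_m [dl dl0 red_l] n m l.
have [dn dn0 {}red_n] := red_n n; have [dm dm0 {}red_m] := red_m m.
(* The orbit behind [g] begins one step below l, so the base point is moved there. *)
rewrite -(subrK 1 l); move: (l - 1) => {}l.
pose F n m l := seqdet (rows n m l); pose G n m l := seqdet_gap (rows n m l).
have fE n' m' l' : f n' m' l' = F n' m' l' by [].
have gE n' m' l' : g n' m' (l' + 1) = G n' m' l' by exact: cas_g_orbit.
have tw_n n' m' l' : twist (delta - a) (rows n' m' l') = rows (n' + 1) m' l'.
  by apply: twist_orbit_rows => k; exact: psi_n.
have tw_m n' m' l' : twist (delta - b) (rows n' m' l') = rows n' (m' + 1) l'.
  by apply: twist_orbit_rows => k; exact: psi_m.
have tw_l n' m' l' : twist 0 (rows n' m' l') = rows n' m' (l' + 1).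
  exact: twist0_orbit_rows.
have redF_n m' l' : seqdet (twist (a + delta) (rows (n + 1) m' l')) = dn * F n m' l'.
  by case: (red_n m' l').
have redG_n m' l' :
    seqdet_gap (twist (a + delta) (rows (n + 1) m' l')) = dn * G n m' l'.
  by case: (red_n m' l').
have redF_m n' l' : seqdet (twist (b + delta) (rows n' (m + 1) l')) = dm * F n' m l'.
  by case: (red_m n' l').
have redG_m n' l' :
    seqdet_gap (twist (b + delta) (rows n' (m + 1) l')) = dm * G n' m l'.
  by case: (red_m n' l').
have redF_l n' m' l' :
    seqdet (twist (delta + delta) (rows n' m' (l' + 1))) = dl * F n' m' l'.
  exact: red_l.
rewrite /hat /tld /bar !fE !gE.
split.
- have := seqdet_hirota (delta - b) 0 (a + delta) _ (rows (n + 1) m (l + 1)).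
  rewrite !tw_l !tw_m !tw_l !redF_n -!/(F _ _ _) => H.
  by apply: (mulfI dn0); rewrite mulr0 -[RHS]oppr0 -[in RHS]H; ring.
- have := seqdet_hirota (delta - a) (delta - b) (delta + delta) _
    (rows n m (l + 1 + 1)).
  rewrite !(tw_n, tw_m) !redF_l -!/(F _ _ _) => H.
  by apply: (mulfI dl0); rewrite mulr0 -[RHS]oppr0 -[in RHS]H; ring.
- have := seqdet_gap_identity (delta - a) (delta - b) _ (rows n m l).
  rewrite !tw_l !(tw_n, tw_m) -!/(F _ _ _) -!/(G _ _ _) => H.
  by rewrite -[RHS]H; ring.
have := seqdet_gap_identity (a + delta) (delta - b) _ (rows (n + 1) m l).
rewrite !tw_l !tw_m !redF_n !redG_n -!/(F _ _ _) -!/(G _ _ _) => Hn.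
have := seqdet_gap_identity (b + delta) (delta - a) _ (rows n (m + 1) l).
rewrite !tw_l !tw_n !redF_m !redG_m -!/(F _ _ _) -!/(G _ _ _) => Hm.
apply: (mulfI dn0); apply: (mulfI dm0); rewrite !mulr0.
(* [Hn] carries the factor [dn] and [Hm] the factor [dm]. After cross-multiplication the two
   products free of [g] are common to both and cancel. *)
have lin x y z : x = 0 -> y = 0 -> z = dn * x - dm * y -> z = 0.
  by move=> -> -> ->; rewrite !mulr0 subrr.
by apply: lin Hm Hn _; ring.
Qed.

End SequenceDeterminants.

(** * The reductions supplied by the auxiliary functions *)

Theorem theorem2 (R : realType) (N : nat) (N_ge1 : (1 <= N)%N)
  (a b delta : R[i]) (psi sigma phi : lattice 'cV[R[i]]_N)
  (Al An Am : int -> 'M[R[i]]_N)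
  (psi_n : forall n m l,
     bar psi n m l = tld psi n m l + (delta - a) *: psi n m l)
  (psi_m : forall n m l,
     bar psi n m l = hat psi n m l + (delta - b) *: psi n m l)
  (Al_transform : transform_matrix Al)
  (An_transform : transform_matrix An)
  (Am_transform : transform_matrix Am)
  (psi_sigma : forall n m l, psi n m l = Al l *m sigma n m l)
  (sigma_shift : forall n m l,
     under sigma n m l = - hat sigma n m l + (b + delta) *: sigma n m l)
  (psi_phi : forall n m l, psi n m l = An n *m Am m *m phi n m l)
  (phi_shift_n : forall n m l,
     bar phi n m l = - phi (n - 1) m l + (a + delta) *: phi n m l)
  (phi_shift_m : forall n m l,
     bar phi n m l = - phi n (m - 1) l + (b + delta) *: phi n m l) :
  let f := cas_f psi in
  let g := cas_g psi in
  forall n m l : int,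
  [/\ (b - delta) * hat (tld (bar f)) n m l * f n m l
      + (a + delta) * hat (tld f) n m l * bar f n m l
      - (a + b) * tld (bar f) n m l * hat f n m l = 0,
      (a - b) * hat (tld (bar f)) n m l * f n m l
      + (b + delta) * tld (bar f) n m l * hat f n m l
      - (a + delta) * tld f n m l * hat (bar f) n m l = 0,
      - tld (bar f) n m l * hat f n m l
      + (delta - a) * tld (bar f) n m l * hat g n m l
      + tld f n m l * hat (bar f) n m l
      + (b - delta) * hat (bar f) n m l * tld g n m l
      + (a - b) * bar f n m l * hat (tld g) n m l = 0
    & (a - b) * hat (tld (bar f)) n m l * g n m l
      + (a + b) * tld (bar f) n m l * hat g n m l
      - (a + b) * hat (bar f) n m l * tld g n m l
      + (b - a) * bar f n m l * hat (tld g) n m l = 0].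

Proof.
case: N N_ge1 psi sigma phi Al An Am psi_n psi_m Al_transform An_transform
  Am_transform psi_sigma sigma_shift psi_phi phi_shift_n phi_shift_m => [//|N] _.
move=> psi sigma phi Al An Am psi_n psi_m [Al_unit Al_ratio] [An_unit _] [Am_unit _].
move=> psi_sigma sigma_shift psi_phi phi_shift_n phi_shift_m.
have det_neq0 (A B : 'M[R[i]]_N.+1) : A \in unitmx -> B \in unitmx ->
    \det (- (A *m invmx B)) != 0.
  move=> A_unit B_unit; rewrite -unitfE -unitmxE -scaleN1r unitmxZ ?unitrN1 //.
  by rewrite unitmx_mul unitmx_inv A_unit.
apply: bilinear_of_reductions; [exact: psi_n | exact: psi_m | | |].
- move=> n; pose D := - (An (n + 1) *m invmx (An n)).
  exists (\det D); first exact: det_neq0.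
  move=> m l; apply: seqdet_reduction => k.
  have := phi_shift_n (n + 1) m k; rewrite /bar addrK => phi_k.
  rewrite psi_phi phi_k mulmxDr -scalemxAr -psi_phi; congr (_ + _).
  by rewrite psi_phi /D mulmxN !mulNmx !mulmxA (mulmxKV (An_unit n)).
- move=> m; pose D := - (Am (m + 1) *m invmx (Am m)).
  exists (\det D); first exact: det_neq0.
  (* [Am] stands to the right of [An], so the matrix relating m + 1 to m is a conjugate of [D] by
     [An n]; it depends on n, but its determinant does not. *)
  move=> n l; have -> : \det D = \det (An n *m D *m invmx (An n)).
    by rewrite !det_mulmx mulrAC -det_mulmx mulmxV ?An_unit // det1 mul1r.
  apply: seqdet_reduction => k.
  have := phi_shift_m n (m + 1) k; rewrite /bar addrK => phi_k.
  rewrite psi_phi phi_k mulmxDr -scalemxAr -psi_phi; congr (_ + _).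
  by rewrite psi_phi /D !(mulmxN, mulNmx) !mulmxA (mulmxKV (An_unit n)) (mulmxKV (Am_unit m)).
pose D := - (Al 1 *m invmx (Al 0)).
exists (\det D); first exact: det_neq0.
(* The orbit runs along l itself, so one matrix must serve all columns; the constant ratio of [Al]
   provides it. *)
have Al_step k : Al k = Al 1 *m invmx (Al 0) *m Al (k - 1).
  have := Al_ratio (k - 1) 0; rewrite add0r subrK => /(congr1 (mulmx^~ (Al k))).
  rewrite (mulmxKV (Al_unit k)) => ->.
  by rewrite !mulmxA (mulmxKV (Al_unit 0)) (mulmxV (Al_unit 1)) mul1mx.
move=> n m l.
(* Adding the [sigma] relation, multiplied by [Al k], to the hat relation for [psi] eliminates the
   hat shift and b, leaving a three-term recurrence in l. *)
have psi_step k : psi n m (k + 1) =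
    D *m psi n m (k - 1) + (delta + delta) *: psi n m k.
  have psi_k : psi n m (k + 1) = psi n (m + 1) k + (delta - b) *: psi n m k.
    exact: psi_m.
  have sigma_k : Al k *m sigma n m (k - 1) =
      - psi n (m + 1) k + (b + delta) *: psi n m k.
    have := sigma_shift n m k; rewrite /under /hat => ->.
    by rewrite mulmxDr mulmxN -scalemxAr -!psi_sigma.
  rewrite (psi_sigma _ _ (k - 1)) mulmxA mulNmx -Al_step mulNmx sigma_k psi_k.
  rewrite opprD opprK -addrA -scaleNr -scalerDl.
  by congr (_ + _ *: _); rewrite opprD addrACA addNr addr0 addrC.
have rows_shift : orbit_rows _ (fun k => psi n m (k - 1)) (l + 1) =
    orbit_rows _ (psi n m) l.
  apply: functional_extensionality => i; apply: functional_extensionality => j.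
  by rewrite /orbit_rows addrAC addrK.
have [det_eq _] := seqdet_reduction _ _ D (psi n m) (fun k => psi n m (k - 1)) _
  psi_step (l + 1).
by rewrite rows_shift in det_eq.
Qed.
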